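(* Let $X$ be a metrizable uniform space. If $X$ is weakly chained, then $X$ is locally uniformly joinable.
   Context: Entourages: throughout, entourages of a uniform space are taken to be symmetric (the symmetric entourages form a base of the uniform structure); every entourage contains the diagonal. For a metric space $(X,d)$, the induced uniform structure has as a base the sets $E_\epsilon=\{(x,y)\in X\times X : d(x,y)\le\epsilon\}$, $\epsilon>0$. A uniform space is metrizable if its uniform structure is induced by some metric. Chains: given an entourage $E$ of a uniform space $X$, an $E$-chain is a finite sequence $x_1,\dots,x_n$ of points of $X$ with $(x_i,x_{i+1})\in E$ for each $i<n$; it joins $x_1$ to $x_n$. The space $X$ is chain connected if for every entourage $E$ any two points of $X$ can be joined by an $E$-chain. Homotopy of chains: a subset $A\subset X$ is $E$-bounded if $A\times A\subset E$. The Rips complex $R(X,E)$ is the simplicial complex with vertex set $X$ whose simplices are the finite $E$-bounded subsets of $X$. An $E$-chain determines an edge path in $R(X,E)$ by joining successive terms by edges. Two $E$-chains with the same initial point and the same final point are $E$-homotopic if the corresponding paths in $R(X,E)$ are homotopic relative to endpoints; equivalently, one can be transformed into the other by finitely many moves, each adding or deleting a single point and yielding an $E$-chain, with endpoints kept fixed. The $E$-homotopy class of an $E$-chain $c$ is denoted $[c]_E$. Generalized paths: a generalized path from $x$ to $y$ in $X$ is a family $\alpha=\{[c_E]_E\}_E$, indexed by all entourages $E$ of $X$, where each $c_E$ is an $E$-chain from $x$ to $y$ and, whenever $F\subset E$ are entourages, $c_F$ is $E$-homotopic to $c_E$. Write $\alpha_E=[c_E]_E$. A generalized path $\alpha$ from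 $x$ to $y$ is $E$-short if $(x,y)\in E$ and $\alpha_E=[x,y]_E$, the class of the two-term $E$-chain $x,y$. A uniform space $X$ is locally uniformly joinable if for each entourage $E$ of $X$ there is an entourage $F$ of $X$ such that whenever $(x,y)\in F$, the points $x$ and $y$ can be joined by an $E$-short generalized path. A uniform space $X$ is weakly chained if it is chain connected and for every entourage $E$ of $X$ there exists an entourage $F\subset E$ such that for every $(x,y)\in F$ there exist arbitrarily fine chains $c$ joining $x$ to $y$ with $[c]_E=[x,y]_E$; that is, for every entourage $D\subset E$ there is a $D$-chain $c$ from $x$ to $y$ with $[c]_E=[x,y]_E$. *)

(* Defs.v *)
From Stdlib Require Import Relation_Operators.
From mathcomp Require Import all_boot all_order all_algebra.
From mathcomp Require Import all_classical all_reals topology.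

Set Implicit Arguments.
Unset Strict Implicit.
Unset Printing Implicit Defensive.

Import Order.TTheory GRing.Theory Num.Theory.

Local Open Scope classical_set_scope.
Local Open Scope ring_scope.

(* A metric on a bare type, as a predicate: a [metricType] would carry its own
   uniform structure, whereas [metrizable] compares with a given one. *)
Definition is_metric (R : realType) (T : Type) (d : T -> T -> R) : Prop :=
  [/\ forall x y, 0 <= d x y,
      forall x y, d x y = 0 <-> x = y,
      forall x y, d x y = d y x &
      forall x y z, d x z <= d x y + d y z].

Definition metrizable (R : realType) (X : uniformType) : Prop :=
  exists2 d : X -> X -> R, is_metric d &
    @entourage X =
      filter_from [set e : R | 0 < e] (fun e => [set p | d p.1 p.2 <= e]).

(* Every quantification over entourages below ranges over the symmetric ones,
   which form a base of the uniform structure. *)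
Record sym_entourage (X : uniformType) := SymEntourage {
  ent_set :> set (X * X);
  sym_entourageP : entourage ent_set;
  sym_entourage_sym : forall x y,
    ent_set (x, y) -> ent_set (y, x)
}.

(* [c] is a nonempty sequence x = x_1, ..., x_n = y with consecutive terms
   in [E]; n = 1 is allowed. *)
Definition is_chain (T : Type) (E : set (T * T)) (x y : T) (c : seq T) : Prop :=
  if c is a :: s then
    [/\ a = x, path [rel u v | (u, v) \in E] a s & last a s = y]
  else False.

Definition chain_connected (X : uniformType) : Prop :=
  forall (E : sym_entourage X) (x y : X), exists c, is_chain E x y c.

(* Insertion of one point; since both sequences are chains from x to y, the
   endpoints are kept. Deletion is the converse relation. *)
Inductive chain_insert (T : Type) (E : set (T * T)) (x y : T) :
    seq T -> seq T -> Prop :=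
  ChainInsert s1 z s2 of
    is_chain E x y (s1 ++ s2) & is_chain E x y (s1 ++ z :: s2) :
    chain_insert E x y (s1 ++ s2) (s1 ++ z :: s2).

(* For an E-chain c from x to y: homotopy relative to the endpoints in the Rips
   complex R(X, E), expressed by finitely many insertions and deletions. *)
Definition chain_homotopic (T : Type) (E : set (T * T)) (x y : T) :
    seq T -> seq T -> Prop :=
  clos_refl_sym_trans (seq T) (chain_insert E x y).

(* [c]_E *)
Definition chain_class (T : Type) (E : set (T * T)) (x y : T) (c : seq T) :
    set (seq T) :=
  [set c' | chain_homotopic E x y c c'].

Record generalized_path (X : uniformType) (x y : X) := GeneralizedPath {
  gpath_class :> sym_entourage X -> set (seq X);
  gpathP : exists c : sym_entourage X -> seq X,
    [/\ forall E : sym_entourage X, is_chain E x y (c E),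
        forall E F : sym_entourage X, F `<=` E ->
          chain_homotopic E x y (c F) (c E) &
        forall E : sym_entourage X, gpath_class E = chain_class E x y (c E)]
}.

Definition short (X : uniformType) (E : sym_entourage X) (x y : X)
    (alpha : generalized_path x y) : Prop :=
  ent_set E (x, y) /\ alpha E = chain_class E x y [:: x; y].

Definition locally_uniformly_joinable (X : uniformType) : Prop :=
  forall E : sym_entourage X, exists F : sym_entourage X,
    forall x y : X, ent_set F (x, y) ->
      exists alpha : generalized_path x y, short E alpha.

Definition weakly_chained (X : uniformType) : Prop :=
  chain_connected X /\
  forall E : sym_entourage X, exists2 F : sym_entourage X, F `<=` E &
    forall x y : X, ent_set F (x, y) ->
      forall D : sym_entourage X, D `<=` E ->
        exists2 c : seq X, is_chain D x y c &
          chain_class E x y c = chain_class E x y [:: x; y].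

(* Main.v *)
From Stdlib Require Import Relation_Operators.
Require Import Defs.
From mathcomp Require Import all_boot all_order all_algebra.
From mathcomp Require Import all_classical all_reals topology.

(** Only a countable base [B_0, B_1, ...] of the uniformity is used, which the
    balls of radius [1 / (n + 1)] provide when [X] is metrizable.  Fix an
    entourage [E].  Weak chaining attaches to every entourage [E'] an entourage
    [F(E')] whose pairs can be replaced by arbitrarily fine chains without
    changing their [E']-homotopy class.  Put [E_0 = E] and choose [E_(n+1)]
    inside both [F(E_n)] and [B_n]; the [E_n] are then a decreasing base.

    For [(x, y)] in [E_1] start from the chain [c_0 = x, y].  Given an
    [E_(n+1)]-chain [c_n], each of its steps lies in [F(E_n)], hence may be
    replaced by an [E_(n+2)]-chain in the same [E_n]-homotopy class; joining the
    pieces gives [c_(n+1)] ([chain_refinement]).  By induction all [c_m] with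
    [n <= m] are [E_n]-homotopic ([refining_sequence]), so the sequence converges
    to a generalized path: at an entourage [D] its value is the class of [c_n],
    with [n] least such that [E_n] is contained in [D]
    ([gpath_of_refining_sequence]).  At [E = E_0] this least [n] is [0], so
    the value is the class of [x, y], which is shortness. *)

Set Implicit Arguments.
Unset Strict Implicit.
Unset Printing Implicit Defensive.

Import Order.TTheory GRing.Theory Num.Theory.

Local Open Scope classical_set_scope.

(** * Homotopy of chains *)

Section Chains.
Variable T : Type.
Implicit Types (E F D : set (T * T)) (x y z : T) (c d : seq T).

Lemma is_chainP E x y c : is_chain E x y c <->
  exists s, [/\ c = x :: s, path [rel u v | (u, v) \in E] x s & last x s = y].
Proof.
split; first by case: c => [//|a s] [<- ? ?]; exists s.
by case=> s [-> ? ?].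
Qed.

Lemma is_chainS E F x y c : E `<=` F -> is_chain E x y c -> is_chain F x y c.
Proof.
move=> EF /is_chainP[s [-> p l]]; split=> //.
by apply: sub_path p => u v /=; rewrite !in_setE; exact: EF.
Qed.

Lemma is_chain2 E x y : E (x, y) -> is_chain E x y [:: x; y].
Proof. by move=> Exy; split=> //=; rewrite andbT in_setE. Qed.

(** The second chain starts where the first one ends, hence the [behead]. *)
Lemma is_chain_cat E x y z c d :
  is_chain E x y c -> is_chain E y z d -> is_chain E x z (c ++ behead d).
Proof.
move=> /is_chainP[s [-> ps ls]] /is_chainP[t [-> pt lt]].
by split; rewrite //= ?cat_path ?last_cat ls // ps.
Qed.

Lemma clos_rst_homo (A B : Type) (r : A -> A -> Prop) (r' : B -> B -> Prop)
    (f : A -> B) :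
  (forall a b, r a b -> r' (f a) (f b)) ->
  forall a b, clos_refl_sym_trans A r a b ->
    clos_refl_sym_trans B r' (f a) (f b).
Proof.
move=> rf a b; elim=> {a b} [a b /rf|a|a b _|a b c _ + _].
- exact: rst_step.
- exact: rst_refl.
- exact: rst_sym.
- exact: rst_trans.
Qed.

Lemma chain_homotopicS E F x y c d : E `<=` F ->
  chain_homotopic E x y c d -> chain_homotopic F x y c d.
Proof.
move=> EF; apply: (clos_rst_homo (f := id)) => _ _ [s1 z s2 h1 h2].
by constructor; exact: is_chainS EF _.
Qed.

Lemma chain_homotopic_catl E x y z c c' d : is_chain E y z d ->
  chain_homotopic E x y c c' ->
  chain_homotopic E x z (c ++ behead d) (c' ++ behead d).
Proof.
move=> hd; apply: (clos_rst_homo (f := fun c => c ++ behead d)).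
move=> _ _ [s1 w s2 h1 h2]; rewrite -!catA /=.
constructor; first by rewrite catA; exact: is_chain_cat hd.
by rewrite -cat_cons catA; exact: is_chain_cat hd.
Qed.

Lemma chain_homotopic_catr E x y z c d d' : is_chain E x y c ->
  chain_homotopic E y z d d' ->
  chain_homotopic E x z (c ++ behead d) (c ++ behead d').
Proof.
move=> hc; apply: (clos_rst_homo (f := fun d => c ++ behead d)).
move=> _ _ [[|a s1] w s2 h1 h2]; last first.
  rewrite /= !catA; constructor; rewrite -catA.
    exact: (is_chain_cat hc h1).
  exact: (is_chain_cat hc h2).
(* A point inserted in front of [d] is a repetition of [y]: after removal of
   the heads, it is [y] that has been inserted between [c] and the rest. *)
case: s2 h1 h2 => [//|b t] h1 h2 /=.
constructor; first exact: (is_chain_cat hc h1).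
exact: (is_chain_cat hc h2).
Qed.

Lemma chain_homotopic_cat E x y z c c' d d' :
  is_chain E x y c' -> is_chain E y z d ->
  chain_homotopic E x y c c' -> chain_homotopic E y z d d' ->
  chain_homotopic E x z (c ++ behead d) (c' ++ behead d').
Proof.
move=> hc' hd hc hd'; apply: rst_trans (chain_homotopic_catr hc' hd').
exact: chain_homotopic_catl hd hc.
Qed.

(** Replacing each step of a chain by a finer chain in its homotopy class does
    not change the class of the whole, as homotopies can be concatenated. *)
Lemma chain_refinement E F D : D `<=` E -> F `<=` E ->
  (forall x y, F (x, y) ->
    exists2 c, is_chain D x y c & chain_homotopic E x y [:: x; y] c) ->
  forall x y c, is_chain F x y c ->
    exists2 c', is_chain D x y c' & chain_homotopic E x y c c'.
Proof.
move=> DE FE step x y c /is_chainP[s [-> {c}]].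
elim: s x => [|b s IH] x /=.
  by move=> _ <-; exists [:: x]; [split | exact: rst_refl].
case/andP; rewrite in_setE => Fxb ps ls.
have [c1 c1D c1E] := step _ _ Fxb; have [c2 c2D c2E] := IH _ ps ls.
exists (c1 ++ behead c2); first exact: is_chain_cat c2D.
apply: (chain_homotopic_cat (c := [:: x; b]) (d := b :: s)) c1E c2E.
  exact: is_chainS c1D.
by apply: (is_chainS FE); split.
Qed.

(** * Sequences of successively refined chains *)

(** [c n] is built as an [E n.+1]-chain, one index finer than the conclusion
    records: its steps must be pairs that can be replaced at level [n]. *)
Lemma refining_sequence (E : nat -> set (T * T)) x y :
  (forall n, E n.+1 `<=` E n) ->
  (forall n u v, E n.+1 (u, v) -> exists2 c, is_chain (E n.+2) u v c &
    chain_homotopic (E n) u v [:: u; v] c) ->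
  E 1 (x, y) ->
  exists c : nat -> seq T, [/\ c 0 = [:: x; y],
    forall n, is_chain (E n) x y (c n) &
    forall n m, (n <= m)%N -> chain_homotopic (E n) x y (c m) (c n)].
Proof.
move=> ES step Exy.
have /choice[g gP] (nc : nat * seq T) : exists c',
    is_chain (E nc.1.+1) x y nc.2 ->
    is_chain (E nc.1.+2) x y c' /\ chain_homotopic (E nc.1) x y nc.2 c'.
  case: nc => n c /=; have [ch|] := pselect (is_chain (E n.+1) x y c);
    last by exists c.
  have ESS : E n.+2 `<=` E n by apply: subset_trans (ES _).
  by have [c'] := chain_refinement ESS (ES n) (step n) ch; exists c'.
pose c := fix c n := if n is k.+1 then g (k, c k) else [:: x; y].
have cP n : is_chain (E n.+1) x y (c n).
  by elim: n => [|n /(gP (n, _))[]//]; exact: is_chain2.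
exists c; split=> // [n|n m]; first exact: is_chainS (cP n).
elim: m => [|m IH]; first by rewrite leqn0 => /eqP->; exact: rst_refl.
rewrite leq_eqVlt => /predU1P[->|]; first exact: rst_refl.
rewrite ltnS => nm; apply: rst_trans (IH nm); apply: rst_sym.
have Enm : E m `<=` E n.
  apply: (homo_leq (r := fun A B => B `<=` A) _ _ ES nm) => [A|B A C AB BC].
    exact: subset_refl.
  exact: subset_trans AB.
have [_] := gP (m, c m) (cP m); exact: chain_homotopicS.
Qed.

End Chains.

(** * Generalized paths *)

Section GeneralizedPaths.
Variable X : uniformType.
Implicit Types (E D : sym_entourage X).

(** Compatibility holds because a finer entourage is reached no earlier by the
    decreasing base; taking the least index makes the value computable at the
    terms of the base themselves. *)
Lemma gpath_of_refining_sequence (E : nat -> sym_entourage X) (x y : X)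
    (c : nat -> seq X) :
  (forall D, exists n, E n `<=` D) ->
  (forall n, is_chain (E n) x y (c n)) ->
  (forall n m, (n <= m)%N -> chain_homotopic (E n) x y (c m) (c n)) ->
  exists alpha : generalized_path x y, forall D, exists n,
    [/\ E n `<=` D, forall m, E m `<=` D -> (n <= m)%N &
        alpha D = chain_class D x y (c n)].
Proof.
move=> base cE cc.
have /choice[i iP] D :
    exists n, E n `<=` D /\ forall m, E m `<=` D -> (n <= m)%N.
  have [n ED] := base D.
  have [|k /asboolP ? km] := @ex_minnP (fun n => `[< E n `<=` D >]).
    by exists n; exact/asboolP.
  by exists k; split=> // m ?; apply/km/asboolP.
unshelve eexists.
  exists (fun D => chain_class D x y (c (i D))); exists (fun D => c (i D)).
  split=> // [D|D F FD]; have [EiD Dmin] := iP D; first exact: is_chainS (cE _).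
  have [EiF _] := iP F; apply: chain_homotopicS EiD _; apply: cc.
  exact/Dmin/(subset_trans EiF).
by move=> D; exists (i D); have [? ?] := iP D; split.
Qed.

Lemma metrizable_countable_uniformity (R : realType) :
  metrizable R X -> countable_uniformity X.
Proof.
case=> d _ entE; apply/countable_uniformityP.
exists (fun n => [set p | (d p.1 p.2 <= n.+1%:R^-1)%R]); rewrite entE.
  move=> A [e /= e0 eA]; exists (Num.truncn e^-1).
  apply: subset_trans eA => p /= /le_trans; apply.
  by rewrite -[leRHS]invrK lef_pV2 ?posrE ?invr_gt0// ltW// truncnS_gt.
by move=> n; exists (n.+1%:R^-1)%R; rewrite //= invr_gt0.
Qed.

Lemma sym_entourage_meet E (A : set (X * X)) : entourage A ->
  exists F : sym_entourage X, F `<=` E /\ F `<=` A.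
Proof.
move=> eA; have eEA : entourage (E `&` (A `&` A^-1)%relation).
  by apply: filterI; [exact: sym_entourageP | exact: entourage_invI].
unshelve eexists.
  exists (E `&` (A `&` A^-1)%relation) => // x y [Exy [Axy Ayx]].
  by split; first exact: sym_entourage_sym.
by split=> -[x y] [? []].
Qed.

(** Each term is taken inside the entourage that weak chaining attaches to the
    preceding one, and inside the next member of the countable base so that the
    sequence becomes a base itself. *)
Lemma weakly_chained_base : countable_uniformity X -> weakly_chained X ->
  forall E, exists En : nat -> sym_entourage X,
    [/\ En 0 = E, forall n, En n.+1 `<=` En n,
        forall D, exists n, En n `<=` D &
        forall n u v, ent_set (En n.+1) (u, v) ->
          exists2 c, is_chain (En n.+2) u v c &
            chain_homotopic (En n) u v [:: u; v] c].
Proof.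
move=> /countable_uniformityP[B Bbase entB] [_ wc] E.
have /choice[G GP] (nE : nat * sym_entourage X) :
    exists F : sym_entourage X, [/\ F `<=` nE.2, F `<=` B nE.1 &
      forall u v, ent_set F (u, v) -> forall D, D `<=` nE.2 ->
        exists2 c, is_chain D u v c & chain_homotopic nE.2 u v [:: u; v] c].
  case: nE => n E' /=; have [F FE' FP] := wc E'.
  have [F' [F'F F'B]] := sym_entourage_meet F (entB n).
  exists F'; split=> // [|u v /F'F Fuv D DE']; first exact: subset_trans FE'.
  have [c cD cE'] := FP _ _ Fuv _ DE'; exists c => //.
  have : chain_class E' u v c [:: u; v] by rewrite cE'; exact: rst_refl.
  exact: rst_sym.
pose En := fix En n := if n is k.+1 then G (k, En k) else E.
have EnS n : En n.+1 `<=` En n by have [] := GP (n, En n).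
exists En; split=> // [D|n u v Enuv].
  have [n BD] := Bbase D (sym_entourageP D); exists n.+1.
  by have [_ EB _] := GP (n, En n); exact: subset_trans BD.
have [_ _ step] := GP (n, En n).
by apply: (step _ _ Enuv); exact: subset_trans (EnS n).
Qed.

Lemma weakly_chained_locally_uniformly_joinable :
  countable_uniformity X -> weakly_chained X -> locally_uniformly_joinable X.
Proof.
move=> cX wX E; have [En [En0 EnS base step]] := weakly_chained_base cX wX E.
exists (En 1) => x y En1xy.
have [c [c0 cE cc]] := refining_sequence EnS step En1xy.
have [alpha alphaP] := gpath_of_refining_sequence base cE cc.
exists alpha; split; first by rewrite -En0; exact: EnS.
(* As [En 0 = E], the least index for [E] is [0], where the chain is [x, y]. *)
have [n [_ nmin ->]] := alphaP E.
have : (n <= 0)%N by apply: nmin; rewrite En0.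
by rewrite leqn0 => /eqP->; rewrite c0.
Qed.

End GeneralizedPaths.

Theorem proposition3p1 (R : realType) (X : uniformType)
  (hX : metrizable R X) (hw : weakly_chained X) :
  locally_uniformly_joinable X.
Proof.
apply: weakly_chained_locally_uniformly_joinable hw.
exact: metrizable_countable_uniformity hX.
Qed.
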